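(* Let $G$ split as a graph of groups over a finite graph $\Gamma$, and suppose that each vertex group commands its collection of incident edge groups. Then: (1) For any vertex group $G_v<G$, the profinite topology on $G_v$ coincides with the subspace topology on $G_v$ induced by the profinite topology on $G$. (2) If every incident edge group is separable in its corresponding vertex group, then the vertex groups are separable in $G$. (3) If every vertex group is residually finite and every incident edge group is separable in its corresponding vertex group, then $G$ is residually finite.
   Context: For $G$ split as a graph of groups over a (connected) graph $\Gamma$, the vertex and edge groups are $G_v$ ($v\in V\Gamma$) and $G_e$ ($e\in E\Gamma$ an oriented edge), with $G_e=G_{\bar e}$ where $\bar e$ is $e$ with reversed orientation; $\tau(e)$ is the terminal vertex of $e$, and the (injective) edge morphisms are $\zeta_e:G_e\to G_{\tau(e)}$. Vertex and edge groups are also regarded as subgroups of $G$ (well-defined up to conjugation). The collection of incident edge groups of $G_v$ is $(\zeta_e(G_e)\mid\tau(e)=v)$. A group $A$ commands a collection of subgroups $(P_1,\dots,P_n)$ (repetitions allowed) if there exist finite-index subgroups $\dot P_i<P_i$ such that, for any choice of finite-index subgroups $P_i'<\dot P_i$ with $P_i'\triangleleft P_i$, there exists a finite-index normal subgroup $A'\triangleleft A$ such that $P_i\cap A'=P_i'$ for all $1\le i\le n$. The profinite topology on a group has as basis all cosets of finite-index subgroups. A subset is separable if it is closed in the profinite topology; a subgroup is separable if and only if it is an intersection of finite-index subgroups. A group is residually finite if its trivial subgroup is separable. *)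

(* Defs.v *)
From HB Require Import structures.
From mathcomp Require Import all_boot.
From mathcomp Require Import all_classical.
From mathcomp Require Import topology_structure initial_topology.

Set Implicit Arguments.
Unset Strict Implicit.
Unset Printing Implicit Defensive.

Local Open Scope classical_set_scope.
Local Open Scope group_scope.

Section Subgroups.
Variable G : groupType.
Implicit Types (H K : set G) (x : G).

Definition subgroup H := H 1 /\ forall x y, H x -> H y -> H (x / y).

Definition left_coset x H : set G := [set x * y | y in H].

(* K is a subgroup of finite index of H *)
Definition finite_index H K :=
  [/\ subgroup K, K `<=` H & finite_set [set left_coset x K | x in H]].

(* H normalises K; normality of K in H when K is a subgroup of H *)
Definition normalised H K := forall x y, H x -> K y -> K (y ^ x).

Lemma subgroupT : subgroup setT.
Proof. by []. Qed.

Lemma subgroupI H K : subgroup H -> subgroup K -> subgroup (H `&` K).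
Proof.
by move=> [H1 HF] [K1 KF]; split=> // x y [Hx Kx] [Hy Ky]; split; auto.
Qed.

Lemma subgroupV H x : subgroup H -> H x -> H x^-1.
Proof. by move=> [H1 HF] Hx; rewrite -div1g; exact: HF. Qed.

Lemma subgroupM H x y : subgroup H -> H x -> H y -> H (x * y).
Proof.
by move=> gH Hx Hy; rewrite -[y]invgK; apply: gH.2 => //; exact: subgroupV.
Qed.

Lemma left_cosetE x H : left_coset x H = [set y | H (x^-1 * y)].
Proof.
apply/seteqP; split=> [_ [y Hy <-]|y Hy] /=; first by rewrite mulKg.
by exists (x^-1 * y); rewrite ?mulVKg.
Qed.

Lemma left_cosetI x H K :
  left_coset x (H `&` K) = left_coset x H `&` left_coset x K.
Proof. by rewrite !left_cosetE. Qed.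

Lemma left_coset_refl x H : subgroup H -> left_coset x H x.
Proof. by case=> H1 _; rewrite left_cosetE /= mulVg. Qed.

Lemma left_coset_eq x y H : subgroup H -> left_coset x H y ->
  left_coset y H = left_coset x H.
Proof.
rewrite !left_cosetE /= => gH xy; apply/seteqP; split=> z /= yz.
  have -> : x^-1 * z = (x^-1 * y) * (y^-1 * z) by rewrite mulgA mulgK.
  exact: subgroupM.
have -> : y^-1 * z = (x^-1 * y)^-1 * (x^-1 * z).
  by rewrite invgM invgK mulgA mulgK.
by apply: subgroupM => //; exact: subgroupV.
Qed.

Lemma finite_indexT : finite_index setT setT.
Proof.
split=> //; apply: (@sub_finite_set _ _ [set setT]); last exact: finite_set1.
by move=> _ [x _ <-] /=; rewrite left_cosetE.
Qed.

Lemma finite_indexI H K :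
  finite_index setT H -> finite_index setT K -> finite_index setT (H `&` K).
Proof.
move=> [gH _ fH] [gK _ fK]; split=> //; first exact: subgroupI.
apply: sub_finite_set (finite_image2 setI fH fK).
move=> _ [x _ <-]; rewrite left_cosetI.
by exists (left_coset x H); [exists x|exists (left_coset x K); [exists x|]].
Qed.

Definition finite_index_coset : set (set G) :=
  [set C | exists x H, finite_index setT H /\ C = left_coset x H].

Lemma finite_index_coset_cover : \bigcup_(C in finite_index_coset) C = setT.
Proof.
apply/seteqP; split=> // x _; exists setT => //.
exists 1, setT; split; first exact: finite_indexT.
by rewrite left_cosetE.
Qed.

Lemma finite_index_coset_join (C D : set G) x :
  finite_index_coset C -> finite_index_coset D -> C x -> D x ->
  exists E, [/\ finite_index_coset E, E x & E `<=` C `&` D].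
Proof.
move=> [y [H [fH ->]]] [z [K [fK ->]]] yx zx.
have [gH _ _] := fH; have [gK _ _] := fK.
exists (left_coset x (H `&` K)); split.
- by exists x, (H `&` K); split=> //; exact: finite_indexI.
- by apply: left_coset_refl; exact: subgroupI.
- by rewrite left_cosetI (left_coset_eq gH yx) (left_coset_eq gK zx).
Qed.

End Subgroups.

(* [profinite G] is [G] endowed with its profinite topology. Every right coset
   of a finite-index subgroup is a left coset of a conjugate, so left cosets
   suffice for the base. *)
Definition profinite (G : groupType) : Type := G.

HB.instance Definition _ (G : groupType) := Choice.on (profinite G).
HB.instance Definition _ (G : groupType) :=
  @isBaseTopological.Build (profinite G) (set G) (@finite_index_coset G) id
    (@finite_index_coset_cover G) (@finite_index_coset_join G).

Definition profinite_open (G : groupType) (U : set G) :=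
  open (U : set (profinite G)).

(* [U] is open in the topology induced on [H] by the profinite topology of [G]
   along [f], i.e. the subspace topology when [f] is the inclusion of [H]. *)
Definition induced_open (H G : groupType) (f : H -> G) (U : set H) :=
  open (U : set (initial_topology (f : H -> profinite G))).

Definition separable (G : groupType) (A : set G) := closed (A : set (profinite G)).

Definition residually_finite (G : groupType) := separable [set (1 : G)].

Definition commands (A : groupType) (I : finType) (P : I -> set A) :=
  exists Pdot : I -> set A,
    (forall i, finite_index (P i) (Pdot i)) /\
    forall P' : I -> set A,
      (forall i, finite_index (Pdot i) (P' i) /\ normalised (P i) (P' i)) ->
      exists A' : set A,
        [/\ finite_index setT A', normalised setT A' &
            forall i, P i `&` A' = P' i].

(* A finite graph in the sense of Serre, given by its vertices and its geometric
   edges, each with a reference orientation: the oriented edges are the pairs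
   [(d, b)], and reversing the orientation flips [b]. *)
Record graph := Graph {
  vertex : finType;
  gedge : finType;
  tau : gedge * bool -> vertex }.

Section Graph.
Variable X : graph.

Definition edge : finType := (gedge X * bool)%type.

Definition bar (e : edge) : edge := (e.1, ~~ e.2).

Definition origin (e : edge) : vertex X := tau (bar e).

(* A subgraph is given by its set of geometric edges; it has all the vertices. *)
Definition adjacent (T : {set gedge X}) : rel (vertex X) :=
  [rel u v | [exists e : edge, [&& e.1 \in T, origin e == u & tau e == v]]].

Definition connected (T : {set gedge X}) :=
  (0 < #|vertex X|)%N /\ forall u v, connect (adjacent T) u v.

Definition circuit (c : seq edge) :=
  [&& c != [::],
      cycle [rel e e' | (tau e == origin e') && (e' != bar e)] c &
      uniq (map (@tau X) c)].

Definition spanning_tree (T : {set gedge X}) :=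
  connected T /\ forall c, circuit c -> ~~ all (fun e => e.1 \in T) c.

End Graph.

(* Edge groups are indexed by geometric edges, so that the groups of [e] and
   [bar e] are the same. *)
Record graph_of_groups := GraphOfGroups {
  base :> graph;
  vgroup : vertex base -> groupType;
  egroup : gedge base -> groupType;
  zeta : forall e : edge base, UMagmaMorphism.type (egroup e.1) (vgroup (tau e));
  zeta_inj : forall e, injective (zeta e) }.

(* The collection of incident edge groups of [v], indexed by the oriented edges
   with terminal vertex [v]. *)
Definition incident (X : graph_of_groups) (v : vertex X)
    (e : {e : edge X | tau e == v}) : set (vgroup v) :=
  ecast w (set (vgroup w)) (eqP (valP e)) (range (zeta (val e))).

(* The fundamental group of a graph of groups with respect to a set [T] of edges
   (meant to be a spanning tree): it is generated by the vertex groups and the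
   oriented edges, with the relations of the vertex groups, [bar e = e^-1],
   [e * zeta e g * e^-1 = zeta (bar e) g], and [e = 1] for [e] in [T]. *)
Section FundamentalGroup.
Variables (X : graph_of_groups) (T : {set gedge X}).

Definition letter : choiceType := ({v : vertex X & vgroup v} + edge X)%type.

Definition vletter v (g : vgroup v) : letter := inl (existT _ v g).

Definition eletter (e : edge X) : letter := inr e.

Inductive pi1_eq : seq letter -> seq letter -> Prop :=
| pi1_refl w : pi1_eq w w
| pi1_sym w1 w2 : pi1_eq w1 w2 -> pi1_eq w2 w1
| pi1_trans w1 w2 w3 : pi1_eq w1 w2 -> pi1_eq w2 w3 -> pi1_eq w1 w3
| pi1_cat w1 w2 w3 w4 : pi1_eq w1 w2 -> pi1_eq w3 w4 ->
    pi1_eq (w1 ++ w3) (w2 ++ w4)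
| pi1_one v : pi1_eq [:: vletter (1 : vgroup v)] [::]
| pi1_mul v (g h : vgroup v) :
    pi1_eq [:: vletter g; vletter h] [:: vletter (g * h)]
| pi1_rev e : pi1_eq [:: eletter e; eletter (bar e)] [::]
| pi1_edge e (g : egroup e.1) :
    pi1_eq [:: eletter e; vletter (zeta e g); eletter (bar e)]
           [:: vletter (zeta (bar e) g)]
| pi1_tree (e : edge X) : e.1 \in T -> pi1_eq [:: eletter e] [::].

Definition pi1_rel : rel (seq letter) := fun w1 w2 => `[< pi1_eq w1 w2 >].

Lemma pi1_rel_refl : reflexive pi1_rel.
Proof. by move=> w; apply/asboolP; exact: pi1_refl. Qed.

Lemma pi1_rel_sym : symmetric pi1_rel.
Proof. by move=> w1 w2; apply: asbool_equiv_eq; split; exact: pi1_sym. Qed.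

Lemma pi1_rel_trans : transitive pi1_rel.
Proof.
move=> w2 w1 w3 /asboolP w12 /asboolP w23; apply/asboolP.
exact: pi1_trans w12 w23.
Qed.

Canonical pi1_equiv := EquivRel pi1_rel pi1_rel_refl pi1_rel_sym pi1_rel_trans.

Local Open Scope quotient_scope.

Definition pi1 := {eq_quot pi1_equiv}.

HB.instance Definition _ := Choice.on pi1.

Definition pi1_word (w : seq letter) : pi1 := \pi_{eq_quot pi1_equiv} w.

Definition pi1_repr (x : pi1) : seq letter := repr (x : {eq_quot pi1_equiv}).

Lemma pi1_wordP w1 w2 : pi1_word w1 = pi1_word w2 <-> pi1_eq w1 w2.
Proof.
split=> [/eqmodP/asboolP //|w12]; apply/eqmodP; exact/asboolP.
Qed.

Lemma pi1_reprK x : pi1_word (pi1_repr x) = x.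
Proof. exact: reprK. Qed.

Definition inv_letter (l : letter) : letter :=
  match l with
  | inl u => vletter (projT2 u)^-1
  | inr e => eletter (bar e)
  end.

Definition inv_word (w : seq letter) : seq letter := rev (map inv_letter w).

Definition pi1_op (x y : pi1) := pi1_word (pi1_repr x ++ pi1_repr y).

Definition pi1_inv (x : pi1) := pi1_word (inv_word (pi1_repr x)).

Lemma pi1_opE w1 w2 :
  pi1_op (pi1_word w1) (pi1_word w2) = pi1_word (w1 ++ w2).
Proof.
by apply/pi1_wordP; apply: pi1_cat; apply/pi1_wordP; rewrite pi1_reprK.
Qed.

Lemma pi1_opA : associative pi1_op.
Proof.
move=> x y z; rewrite -[x]pi1_reprK -[y]pi1_reprK -[z]pi1_reprK.
by rewrite !pi1_opE catA.
Qed.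

Lemma pi1_op1 : left_id (pi1_word [::]) pi1_op.
Proof. by move=> x; rewrite -[x]pi1_reprK pi1_opE. Qed.

Lemma pi1_op1r : right_id (pi1_word [::]) pi1_op.
Proof. by move=> x; rewrite -[x]pi1_reprK pi1_opE cats0. Qed.

Lemma inv_letterK : involutive inv_letter.
Proof.
by case=> [[v g]|[d b]]; rewrite /= /vletter ?invgK // /eletter /bar negbK.
Qed.

Lemma inv_wordK : involutive inv_word.
Proof. by move=> w; rewrite /inv_word map_rev revK (mapK inv_letterK). Qed.

Lemma pi1_inv_letter l : pi1_eq [:: l; inv_letter l] [::].
Proof.
case: l => [[v g]|e]; last exact: pi1_rev.
by apply: pi1_trans (pi1_mul _ _) _; rewrite mulgV; exact: pi1_one.
Qed.

Lemma pi1_inv_word w : pi1_eq (w ++ inv_word w) [::].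
Proof.
elim: w => [|l w IH]; first exact: pi1_refl.
have -> : (l :: w) ++ inv_word (l :: w) =
    [:: l] ++ ((w ++ inv_word w) ++ [:: inv_letter l]).
  by rewrite /inv_word map_cons rev_cons -cats1 /= catA.
apply: pi1_trans (pi1_inv_letter l).
exact: pi1_cat (pi1_refl _) (pi1_cat IH (pi1_refl _)).
Qed.

Lemma pi1_opV : right_inverse (pi1_word [::]) pi1_inv pi1_op.
Proof.
move=> x; rewrite -[x in pi1_op x]pi1_reprK pi1_opE.
by apply/pi1_wordP; exact: pi1_inv_word.
Qed.

Lemma pi1_opVl : left_inverse (pi1_word [::]) pi1_inv pi1_op.
Proof.
move=> x; rewrite -[x in pi1_op _ x]pi1_reprK pi1_opE.
apply/pi1_wordP; rewrite -[X in _ ++ X]inv_wordK; exact: pi1_inv_word.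
Qed.

HB.instance Definition _ := isGroup.Build pi1
  pi1_opA pi1_op1 pi1_op1r pi1_opVl pi1_opV.

Definition pi1_vertex v (g : vgroup v) : pi1 := pi1_word [:: vletter g].

End FundamentalGroup.

(* A splitting of [G] as a graph of groups over [base X] *)
Record splitting (G : groupType) (X : graph_of_groups) := Splitting {
  tree : {set gedge X};
  tree_spanning : spanning_tree tree;
  iso : UMagmaMorphism.type (pi1 tree) G;
  iso_bij : bijective iso }.

(* The inclusion of a vertex group in [G]; another choice of spanning tree changes
   it by a conjugation in [G]. *)
Definition vertex_incl (G : groupType) (X : graph_of_groups)
    (s : splitting G X) (v : vertex X) (g : vgroup v) : G :=
  iso s (pi1_vertex (tree s) g).

(* Main.v *)
Require Import Defs.
From HB Require Import structures.
From mathcomp Require Import all_boot perm.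
From mathcomp Require Import all_classical.
From mathcomp Require Import topology_structure initial_topology.

(** Finite-index subgroups [A_v] of the vertex groups are called compatible when,
    for each edge, their preimages under its two edge morphisms are the same
    subgroup [N_d] of the edge group. The quotients then form a graph of finite
    groups. The commanding property provides compatible families with [A_v]
    inside any prescribed finite-index subgroups ([compatible_refinement]).

    Each finite quotient [G_v / A_v] acts freely on a common finite set [O]. An
    edge group then acts on [O] in two ways, both free modulo [N_d], and two such
    actions on the same finite set are isomorphic; even a partial isomorphism
    extends to an isomorphism, by matching the remaining orbits one pair at a time
    ([extend_equivariant]). These isomorphisms are the images of the edges in a
    permutation representation of the fundamental group; conjugating the actions
    of the vertex groups along a maximal tree makes the tree edges act trivially
    ([twisted_representation]). The kernel of the representation meets each [G_v]
    in [A_v], which gives the first assertion ([vertex_finite_index]).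

    For the second assertion, an element outside [G_v] is represented by a closed
    word at [v] of minimal length, and this word is reduced and contains an edge.
    Separability of the edge groups allows [A_v] to be so small that the word
    remains reduced modulo the [A_v] ([separating_family]). Now let the finite set
    be several copies of [O], each preserved by the vertex groups, and prescribe
    that each edge letter of the word leads from one copy to the next. The word
    being reduced is exactly what makes these prescriptions a partial isomorphism
    ([no_backtrack]). In the resulting representation the word moves a point to
    another copy, which no element of [G_v] does ([separating_representation]).

    The third assertion follows by topology: the trivial subgroup is closed in
    [G_v], which is closed in [G] and carries the induced topology. *)

Set Implicit Arguments.
Unset Strict Implicit.
Unset Printing Implicit Defensive.

Local Open Scope classical_set_scope.
Local Open Scope group_scope.

(** * Subgroups of finite index *)

(** A colouring of the group by finitely many colours that separates the cosets is
    easier to restrict, pull back and combine than the set of cosets. *)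
Lemma finite_indexP (G : groupType) (H K : set G) :
  finite_index H K <->
  [/\ subgroup K, K `<=` H &
      exists (F : finType) (c : G -> F),
        forall x y, H x -> H y -> c x = c y -> K (x^-1 * y)].
Proof.
split=> [[gK KH /finite_seqP[s Es]]|[gK KH [F [c Hc]]]]; split=> //.
  have ins x : H x -> left_coset x K \in s.
    move=> Hx; have : [set left_coset x K | x in H] (left_coset x K) by exists x.
    by rewrite Es.
  exists 'I_(size s).+1, (fun x => inord (index (left_coset x K) s)).
  move=> x y Hx Hy /(congr1 (@nat_of_ord _)).
  rewrite !inordK ?ltnS ?index_size // => /(congr1 (nth set0 s)).
  rewrite !nth_index ?ins // => xy.
  by move: (left_coset_refl y gK); rewrite -xy left_cosetE.
pose r f := xget 1 [set x | H x /\ c x = f].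
apply: (@sub_finite_set _ _ [set left_coset (r f) K | f in [set: F]]).
  move=> _ [x Hx <-]; exists (c x) => //; rewrite /r.
  case: xgetP => [y -> [Hy yx]|/(_ x)]; last by case.
  by apply/esym/left_coset_eq => //; rewrite left_cosetE; apply: Hc.
exact: finite_image.
Qed.

Lemma finite_index_coloring (G : groupType) (H : set G) :
  finite_index setT H ->
  exists (F : finType) (c : G -> F), forall x y, c x = c y -> H (x^-1 * y).
Proof.
by move=> /finite_indexP[_ _ [F [c Hc]]]; exists F, c => x y; apply: Hc.
Qed.

Lemma finite_index_of_coloring (G : groupType) (H : set G) (F : finType)
    (c : G -> F) :
  subgroup H -> (forall x y, c x = c y -> H (x^-1 * y)) -> finite_index setT H.
Proof.
by move=> gH Hc; apply/finite_indexP; split=> //; exists F, c => x y _ _; apply: Hc.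
Qed.

Definition finite_index_normal (G : groupType) (N : set G) :=
  finite_index setT N /\ normalised setT N.

Lemma finite_index_normalT (G : groupType) : finite_index_normal [set: G].
Proof. by split; first exact: finite_indexT. Qed.

Lemma finite_index_normalI (G : groupType) (M N : set G) :
  finite_index_normal M -> finite_index_normal N ->
  finite_index_normal (M `&` N).
Proof.
move=> [fM nM] [fN nN]; split; first exact: finite_indexI.
by move=> x y _ [My Ny]; split; [apply: nM|apply: nN].
Qed.

Lemma morph_group1 (G K : groupType) (f : G -> K) :
  {morph f : x y / x * y} -> f 1 = 1.
Proof. by move=> fM; apply: (mulgI (f 1)); rewrite -fM !mulg1. Qed.

Lemma morph_groupV (G K : groupType) (f : G -> K) :
  {morph f : x y / x * y} -> {morph f : x / x^-1}.
Proof.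
move=> fM x; apply: (mulgI (f x)).
by rewrite -fM !mulgV (morph_group1 fM).
Qed.

Lemma subgroup_preimage (G K : groupType) (f : G -> K) (H : set K) :
  {morph f : x y / x * y} -> subgroup H -> subgroup (f @^-1` H).
Proof.
move=> fM [H1 HF]; split=> [|x y Hx Hy]; rewrite /preimage /=.
  by rewrite (morph_group1 fM).
by rewrite fM (morph_groupV fM); apply: HF.
Qed.

Lemma finite_index_preimage (G K : groupType) (f : G -> K) (H : set K) :
  {morph f : x y / x * y} ->
  finite_index setT H -> finite_index setT (f @^-1` H).
Proof.
move=> fM fH; have [F [c Hc]] := finite_index_coloring fH; case: fH => gH _ _.
apply: (@finite_index_of_coloring _ _ F (c \o f)); first exact: subgroup_preimage.
by move=> x y /Hc; rewrite /preimage /= fM (morph_groupV fM).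
Qed.

Definition normal_core (G : groupType) (H : set G) : set G :=
  [set x | forall y, H (x ^ y)].

Lemma normal_core_sub (G : groupType) (H : set G) : normal_core H `<=` H.
Proof. by move=> x /(_ 1); rewrite conjg1. Qed.

(** The cosets [x * y * H] for [y] in a finite set of representatives determine
    [x] modulo the core. *)
Lemma normal_core_finite_index (G : groupType) (H : set G) :
  finite_index setT H -> finite_index_normal (normal_core H).
Proof.
move=> fH; have [F [c Hc]] := finite_index_coloring fH; case: fH => gH _ _.
split; last by move=> x y _ Ny z; rewrite -conjgM; exact: Ny.
pose t (i : F) := xget 1 [set x | c x = i].
apply: (@finite_index_of_coloring _ _ {ffun F -> F}
          (fun x => [ffun i => c (x * t i)])).
  split=> [|x y Nx Ny] z; first by rewrite conj1g; case: gH.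
  by rewrite conjMg conjVg; apply: gH.2.
move=> x y /ffunP Exy z.
have Htz : H ((t (c z))^-1 * z).
  by apply: Hc; rewrite /t; case: xgetP => [u -> //|/(_ z)/(_ erefl)].
have := Exy (c z); rewrite !ffunE => /Hc.
move: Htz; set u := t _ => Hu Hxy.
have -> : (x^-1 * y) ^ z = ((x * u)^-1 * (y * u)) ^ (u^-1 * z).
  by rewrite !conjgE !invgM invgK !mulgA !mulgK.
rewrite conjgE; apply: subgroupM => //; first exact: subgroupV.
by apply: subgroupM.
Qed.

(** [Q] is the coset space, [q] the projection and [r] a section of it. *)
Lemma coset_finType (G : groupType) (H : set G) : finite_index setT H ->
  exists (Q : finType) (q : G -> Q) (r : Q -> G),
    cancel r q /\ forall x y, q x = q y <-> H (x^-1 * y).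
Proof.
move=> fH; have [F [c Hc]] := finite_index_coloring fH; case: fH => gH _ _.
(* a coset is encoded by the set of its colours *)
pose q0 x : {set F} := [set i | `[< exists2 y, H (x^-1 * y) & c y = i >]]%SET.
have q0P x y : q0 x = q0 y <-> H (x^-1 * y).
  split=> [/setP/(_ (c x))|Hxy].
    rewrite !inE => /esym; have -> : `[< exists2 z, H (x^-1 * z) & c z = c x >].
      by apply/asboolP; exists x => //; rewrite mulVg; case: gH.
    move=> /asboolP[z Hyz /esym/Hc Hxz].
    have -> : x^-1 * y = (x^-1 * z) * (y^-1 * z)^-1.
      by rewrite invgM invgK mulgA mulgK.
    by apply: subgroupM => //; apply: subgroupV.
  apply/setP => i; rewrite !inE; apply: asbool_equiv_eq.
  split=> -[z Hz <-]; exists z => //.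
    have -> : y^-1 * z = (x^-1 * y)^-1 * (x^-1 * z).
      by rewrite invgM invgK mulgA mulgK.
    by apply: subgroupM => //; apply: subgroupV.
  have -> : x^-1 * z = (x^-1 * y) * (y^-1 * z) by rewrite mulgA mulgK.
  exact: subgroupM.
pose Q := {s : {set F} | `[< exists x, q0 x = s >]}.
have q0Q x : `[< exists y, q0 y = q0 x >] by apply/asboolP; exists x.
pose q x : Q := Sub (q0 x) (q0Q x).
have qP x y : q x = q y <-> H (x^-1 * y).
  by rewrite -q0P; split=> [[]|xy] //; apply: val_inj.
have rP (s : Q) : exists x, q x = s.
  case: s => s /[dup] /asboolP[x <-] Hs; exists x; exact: val_inj.
exists Q, q, (fun s => projT1 (cid (rP s))); split=> // s.
exact: projT2 (cid (rP s)).
Qed.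

(** * Permutation representations *)

Lemma eq_card_bij (A B : finType) : #|A| = #|B| ->
  exists (f : A -> B) (g : B -> A), cancel f g /\ cancel g f.
Proof.
move=> AB; exists (fun x => enum_val (cast_ord AB (enum_rank x))).
exists (fun y => enum_val (cast_ord (esym AB) (enum_rank y))).
by split=> x; rewrite enum_valK ?cast_ordK ?cast_ordKV enum_rankK.
Qed.

(** [G] acts by right translations on the cosets of [N], hence on any disjoint
    union of copies of that coset space. *)
Lemma free_representation (G : groupType) (N : set G) :
  finite_index_normal N ->
  exists n, (0 < n)%N /\ forall O : finType, (n %| #|O|)%N ->
    exists rho : G -> {perm O},
      {morph rho : x y / x * y} /\ forall g o, rho g o = o <-> N g.
Proof.
move=> [fN nN]; have [Q [q [r [rK qP]]]] := coset_finType fN.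
exists #|Q|; split; first by apply/card_gt0P; exists (q 1).
move=> O /dvdnP[k Ek].
have [|f [f' [fK f'K]]] := @eq_card_bij O (Q * 'I_k)%type.
  by rewrite card_prod card_ord Ek mulnC.
pose act g s := q (r s * g).
have actq g y : act g (q y) = q (y * g).
  apply/qP; have -> : (r (q y) * g)^-1 * (y * g) = ((r (q y))^-1 * y) ^ g.
    by rewrite conjgE invgM !mulgA.
  by apply: nN => //; apply/qP; rewrite rK.
have act1 s : act 1 s = s by rewrite /act mulg1 rK.
have actM g h s : act (g * h) s = act h (act g s).
  by rewrite [act g s]/act actq /act mulgA.
pose rf g o := f' (act g (f o).1, (f o).2).
have rf1 : rf 1 =1 id by move=> o; rewrite /rf act1 -surjective_pairing fK.
have rfM g h o : rf (g * h) o = rf h (rf g o) by rewrite /rf f'K /= actM.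
have rf_inj g : injective (rf g).
  by apply: (can_inj (g := rf g^-1)) => o; rewrite -rfM mulgV rf1.
exists (fun g => perm (@rf_inj g)); split=> [g h|g o].
  by apply/permP => o; rewrite permM !permE rfM.
rewrite permE /rf; set s := (f o).1.
have -> : N g <-> q (r s) = q (r s * g) by rewrite qP mulKg.
rewrite rK -/(act g s); split=> [/(congr1 f)|<-].
  by rewrite f'K [RHS]surjective_pairing => -[].
by rewrite -surjective_pairing fK.
Qed.

Lemma free_orbit_map (G : groupType) (O : finType) (rho : G -> {perm O})
    (N : set G) :
  {morph rho : x y / x * y} -> (forall g o, rho g o = o <-> N g) ->
  forall g h o, rho g o = rho h o <-> N (g / h).
Proof.
move=> rhoM rhoN g h o; rewrite -(rhoN _ o) rhoM permM (morph_groupV rhoM).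
split=> [->|/(congr1 (rho h))]; first by rewrite permK.
by rewrite permKV.
Qed.

(** When [R] is not total, finiteness provides a point missed on each side; as
    all stabilisers are equal, these two points have isomorphic orbits and [R]
    can be enlarged by matching them. *)
Lemma extend_equivariant (H : groupType) (O : finType) (al be : H -> {perm O})
    (N : set H) :
  {morph al : x y / x * y} -> {morph be : x y / x * y} ->
  (forall h x, al h x = x <-> N h) -> (forall h x, be h x = x <-> N h) ->
  forall R : O -> O -> Prop,
    (forall h x y, R x y -> R (al h x) (be h y)) ->
    (forall x y y', R x y -> R x y' -> y = y') ->
    (forall x x' y, R x y -> R x' y -> x = x') ->
  exists s : {perm O},
    (forall h x, s (al h x) = be h (s x)) /\ forall x y, R x y -> s x = y.
Proof.
move=> alM beM alN beN R.
have al1 := morph_group1 alM; have be1 := morph_group1 beM.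
have [n] := ubnP #|[set x | `[< forall y, ~ R x y >]]%SET|.
elim: n R => // n IH R; rewrite ltnS => Rn Rinv Rf Ri.
have [Rt|] := pselect (forall x, exists y, R x y).
  pose s x := projT1 (cid (Rt x)).
  have sR x : R x (s x) := projT2 (cid (Rt x)).
  have s_inj : injective s by move=> x x' E; apply: Ri (sR x) _; rewrite E.
  exists (perm s_inj); split=> [h x|x y Rxy]; rewrite !permE; last exact: Rf Rxy.
  by apply: Rf (sR _) _; exact: Rinv.
move=> /existsNP[x0 Nx0]; have {}Nx0 y : ~ R x0 y by move=> ?; apply: Nx0; exists y.
have [y0 Ny0] : exists y0, forall x, ~ R x y0.
  apply: contrapT => NR; have Rs y : exists x, R x y.
    by apply: contrapT => Ny; apply: NR; exists y => x Rxy; apply: Ny; exists x.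
  pose t y := projT1 (cid (Rs y)).
  have tR y : R (t y) y := projT2 (cid (Rs y)).
  have t_inj : injective t by move=> y y' E; apply: Rf (tR y) _; rewrite E.
  have [u _ tK] := injF_bij t_inj.
  by apply: (Nx0 (u x0)); rewrite -[X in R X _]tK.
have alV h x : al h^-1 (al h x) = x by rewrite -permM -alM mulgV al1 perm1.
have beV h x : be h^-1 (be h x) = x by rewrite -permM -beM mulgV be1 perm1.
have NR h x y : R x y -> x <> al h x0 /\ y <> be h y0.
  move=> Rxy; split=> E; move: (Rinv h^-1 _ _ Rxy); rewrite E ?alV ?beV.
    exact: Nx0.
  exact: Ny0.
pose R' x y := R x y \/ exists h, x = al h x0 /\ y = be h y0.
have free (g h : H) : al g x0 = al h x0 <-> be g y0 = be h y0.
  by rewrite (free_orbit_map alM alN) (free_orbit_map beM beN).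
have [||||s [sE sR']] := IH R'.
- apply: leq_trans Rn; apply/proper_card/properP; split.
    apply/fintype.subsetP => x; rewrite !inE => /asboolP Nx; apply/asboolP => y Rxy.
    by apply: (Nx y); left.
  exists x0; rewrite !inE; first by apply/asboolP.
  by apply/asboolP => /(_ y0); apply; right; exists 1; rewrite al1 be1 !perm1.
- move=> h x y [Rxy|[g [-> ->]]]; first by left; exact: Rinv.
  by right; exists (g * h); rewrite alM beM !permM.
- move=> x y y' [Rxy|[g [-> ->]]] [Rxy'|[h [E ->]]].
  + exact: Rf Rxy _.
  + by case: (NR h _ _ Rxy).
  + by case: (NR g _ _ Rxy').
  + exact/free.
- move=> x x' y [Rxy|[g [-> ->]]] [Rxy'|[h [-> E]]].
  + exact: Ri Rxy _.
  + by case: (NR h _ _ Rxy).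
  + by case: (NR g _ _ Rxy').
  + exact/free.
by exists s; split=> // x y Rxy; apply: sR'; left.
Qed.

(** * Forests *)

Section Forest.
Variable X : graph.

Lemma barK : involutive (@bar X).
Proof. by case=> d b; rewrite /bar /= negbK. Qed.

Lemma tau_bar (e : edge X) : tau (bar e) = origin e.
Proof. by []. Qed.

Lemma origin_bar (e : edge X) : origin (bar e) = tau e.
Proof. by rewrite /origin barK. Qed.

Lemma adjacentP (T : {set gedge X}) u v :
  reflect (exists e : edge X, [/\ e.1 \in T, origin e = u & tau e = v])
          (adjacent T u v).
Proof.
by apply: (iffP existsP) => -[e] => [/and3P[? /eqP ? /eqP ?]|[? ? ?]];
  exists e => //; apply/and3P; split=> //; apply/eqP.
Qed.

Lemma connect_adjacent_sym (T : {set gedge X}) : connect_sym (adjacent T).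
Proof.
apply: sym_connect_sym => u v; apply/adjacentP/adjacentP => -[e [Te <- <-]];
  by exists (bar e); rewrite origin_bar tau_bar.
Qed.

(** A path with distinct vertices cannot backtrack, hence lifts to consecutive
    edges of which none is the inverse of the previous one. The initial edge [e]
    is there for the induction. *)
Lemma lift_path (T : {set gedge X}) p (e : edge X) :
  path (adjacent T) (tau e) p -> uniq (tau e :: p) ->
  e.1 \notin T \/ origin e \notin p ->
  exists c : seq (edge X),
    [/\ map (@tau X) c = p, all (fun f => f.1 \in T) c &
        path [rel f f' | (tau f == origin f') && (f' != bar f)] e c].
Proof.
elim: p e => [|y p IH] e; first by exists [::].
rewrite /= => /andP[/adjacentP[f [Tf fo <-]] Tp] /andP[ep fp] He.
have [|c [Ec Tc cp]] := IH f Tp fp.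
  by right; rewrite fo; move: ep; rewrite inE negb_or => /andP[].
exists (f :: c); rewrite /= Ec Tf Tc cp fo eqxx; split=> //; rewrite andbT /=.
apply/eqP => fe; case: He; last by rewrite fe tau_bar inE eqxx.
by rewrite fe in Tf; rewrite Tf.
Qed.

Lemma forest_edge_separates (T : {set gedge X}) (e : edge X) :
  (forall c, circuit c -> ~~ all (fun e => e.1 \in T) c) -> e.1 \in T ->
  ~~ connect (adjacent (T :\ e.1)) (tau e) (origin e).
Proof.
move=> acycT Te; apply/negP => /connectP[p0 /shortenP[p ep Up _] Ep].
(* a simple path between the ends of [e] that avoids [e] closes up to a circuit *)
have [|c [Ec Tc cp]] := lift_path ep Up; first by left; rewrite !inE eqxx.
suff /acycT/negP : circuit (e :: c).
  apply; rewrite /= Te; apply: sub_all Tc => f; by rewrite !inE => /andP[].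
rewrite /circuit /= rcons_path cp Ec; move: Up => /= ->.
rewrite andbT /=.
rewrite -(last_map (@tau X)) Ec -Ep eqxx /=.
apply/eqP => E; have /= := mem_last e c; rewrite inE => /orP[/eqP le|lc].
  by move: E; rewrite le; case: (e) => d [].
by have /(_ _ lc) := allP Tc; rewrite !inE [in eqbRHS]E eqxx.
Qed.

(** Adding an edge to a forest joins two components, and multiplying [h] on the
    right by a constant on one of them adjusts it to the new edge. *)
Lemma forest_potential (gT : groupType) (T : {set gedge X}) (s : edge X -> gT) :
  (forall c, circuit c -> ~~ all (fun e : edge X => e.1 \in T) c) ->
  (forall e, s (bar e) = (s e)^-1) ->
  exists h : vertex X -> gT,
    forall e, e.1 \in T -> h (origin e) = s e * h (tau e).
Proof.
move=> acycT sV; have [n] := ubnP #|T|; elim: n T acycT => // n IH T acycT.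
rewrite ltnS => Tn; have [->|[d Td]] := set_0Vmem T.
  by exists (fun=> 1) => e; rewrite inE.
pose e0 : edge X := (d, true); pose T' := T :\ d.
have [||h hT'] := IH T'.
- move=> c /acycT; apply: contra; apply: sub_all => f.
  by rewrite !inE => /andP[].
- by apply: leq_trans Tn; rewrite [in leqRHS](cardsD1 d) Td.
have sep := @forest_edge_separates T e0 acycT Td.
pose k := (s e0 * h (tau e0))^-1 * h (origin e0).
pose h' u := if connect (adjacent T') (tau e0) u then h u * k else h u.
have h'T' e : e.1 \in T' -> h' (origin e) = s e * h' (tau e).
  move=> Te; rewrite /h' (same_connect_r (connect_adjacent_sym T') (y := tau e)).
    by case: ifP; rewrite (hT' e Te) ?mulgA.
  by apply/connect1/adjacentP; exists e.
have h'e0 : h' (origin e0) = s e0 * h' (tau e0).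
  by rewrite /h' connect0 (negbTE sep) /k mulgA mulVKg.
exists h' => -[d' b] Te; have [E|nE] := eqVneq d' d; last first.
  by apply: h'T'; rewrite !inE nE.
rewrite {}E in Te *; case: b Te => _; first exact: h'e0.
rewrite -[(d, false)]/(bar e0) tau_bar origin_bar sV h'e0.
by rewrite mulKg.
Qed.
End Forest.

(** * Compatible families of finite-index subgroups *)

Section Compatible.
Variable X : graph_of_groups.

(** The quotients by the members of a compatible family form a graph of finite
    groups: the edge morphisms induce injective maps of the quotients. *)
Definition compatible (A : forall v : vertex X, set (vgroup v))
    (N : forall d : gedge X, set (egroup d)) :=
  (forall v, finite_index_normal (A v)) /\
  forall (e : edge X) (g : egroup e.1), A (tau e) (zeta e g) <-> N e.1 g.

Lemma ecast_incident (e : edge X) (ev : tau e == tau e) (P : set (vgroup (tau e))) :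
  ecast w (set (vgroup w)) (eqP ev) P = P.
Proof. by rewrite (eq_irrelevance (eqP ev) erefl). Qed.

Lemma finite_index_image (H G : groupType) (f : UMagmaMorphism.type H G)
    (P : set G) (N : set H) :
  finite_index (range f) P -> finite_index_normal N -> N `<=` f @^-1` P ->
  finite_index P (f @` N) /\ normalised (range f) (f @` N).
Proof.
move=> [gP Pf _] [fN nN] NP; have [F [c Hc]] := finite_index_coloring fN.
case: fN => -[N1 NF] _ _; split; last first.
  move=> _ _ [x _ <-] [y Ny <-]; exists (y ^ x); first exact: nN.
  by rewrite gmulfJ.
apply/finite_indexP; split.
- split=> [|_ _ [x Nx <-] [y Ny <-]]; first by exists 1; rewrite ?gmulf1.
  by exists (x / y); [exact: NF|rewrite gmulfF].
- by move=> _ [x Nx <-]; exact: NP.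
exists F, (fun x => c (xget 1 [set g | f g = x])) => x y Px Py.
case: xgetP => [g _ /= fg|no]; last by have [g _ /no] := Pf _ Px.
case: xgetP => [h _ /= fh|no]; last by have [h _ /no] := Pf _ Py.
by move=> /Hc gh; exists (g^-1 * h); rewrite // gmulfM gmulfV fg fh.
Qed.

(** The family [N] of subgroups of the edge groups is chosen first, inside the
    subgroups provided by the commanding property and inside [K]. Intersecting
    the resulting subgroups of the vertex groups with [K] does not change their
    traces on the edge groups, and this is how arbitrarily small vertex
    subgroups are reached. *)
Lemma compatible_refinement (K : forall v : vertex X, set (vgroup v)) :
  (forall v : vertex X, commands (@incident X v)) ->
  (forall v, finite_index_normal (K v)) ->
  exists A N, compatible A N /\ forall v, A v `<=` K v.
Proof.
move=> cmd fK.
pose Pd v := projT1 (cid (cmd v)); have PdP v := projT2 (cid (cmd v)).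
rewrite -/Pd in PdP.
pose P (e : edge X) : set (vgroup (tau e)) :=
  Pd (tau e) (exist _ e (eqxx (tau e))).
have fP e : finite_index (range (zeta e)) (P e).
  have [/(_ (exist _ e (eqxx (tau e)))) + _] := PdP (tau e).
  by rewrite /incident ecast_incident.
pose M d b : set (egroup d) := zeta (d, b) @^-1` (P (d, b) `&` K (tau (d, b))).
have fM d b : finite_index setT (M d b).
  have [F [c Hc]] := finite_index_coloring (fK (tau (d, b))).1.
  have [gP _ [F' [c' Hc']]] := (finite_indexP _ _).1 (fP (d, b)).
  apply: (@finite_index_of_coloring _ _ (F' * F)%type
            (fun g => (c' (zeta (d, b) g), c (zeta (d, b) g)))).
    apply: subgroup_preimage; first exact: gmulfM.
    apply: subgroupI => //.
    by case: (fK (tau (d, b))) => -[].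
  move=> x y [/Hc' Pxy /Hc Kxy]; rewrite /M /preimage /= gmulfM gmulfV.
  by split=> //; apply: Pxy; [exists x|exists y].
pose N d := normal_core (M d true `&` M d false).
have fN d : finite_index_normal (N d).
  by apply: normal_core_finite_index; exact: finite_indexI.
have NM (e : edge X) : N e.1 `<=` M e.1 e.2.
  by case: e => d [] g /normal_core_sub[].
have NP (e : edge X) : N e.1 `<=` zeta e @^-1` P e.
  by case: e => d b g /(NM (d, b))[].
have NK (e : edge X) : N e.1 `<=` zeta e @^-1` K (tau e).
  by case: e => d b g /(NM (d, b))[].
pose P' v (e : {e : edge X | tau e == v}) : set (vgroup v) :=
  ecast w (set (vgroup w)) (eqP (valP e)) (zeta (val e) @` N (val e).1).
have HA v : exists A' : set (vgroup v), finite_index_normal A' /\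
    forall e, incident e `&` A' = P' v e.
  have [_ /(_ (P' v)) []] := PdP v; last by move=> A' [? ? ?]; exists A'.
  move=> [e ev]; have E := eqP ev; subst v.
  rewrite /incident /P' !ecast_incident /=.
  rewrite (bool_irrelevance ev (eqxx _)).
  exact: finite_index_image (fP e) (fN e.1) (NP e).
pose A' v := projT1 (cid (HA v)); have A'P v := projT2 (cid (HA v)).
rewrite -/A' in A'P.
exists (fun v => A' v `&` K v), N; split; last by move=> v x [].
split=> [v|e g]; first by apply: finite_index_normalI => //; case: (A'P v).
have [_ /(_ (exist _ e (eqxx (tau e))))] := A'P (tau e).
rewrite /incident /P' !ecast_incident /= => E.
split=> [[A'g _]|Ng]; last first.
  split; last exact: NK.
  have : (zeta e @` N e.1) (zeta e g) by exists g.
  by rewrite -E => -[].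
have : (range (zeta e) `&` A' (tau e)) (zeta e g) by split=> //; exists g.
by rewrite E => -[g' Ng' /zeta_inj <-].
Qed.

End Compatible.

(** * Permutation representations of fundamental groups *)

Section Representation.
Variables (X : graph_of_groups) (T : {set gedge X}).

(** The word [w] spells a path from [u] to [v]; several vertex letters may follow
    each other, which makes these words stable under concatenation. *)
Fixpoint word_path (u : vertex X) (w : seq (letter X)) (v : vertex X) :=
  match w with
  | [::] => u == v
  | inl (existT x _) :: w => (x == u) && word_path u w v
  | inr e :: w => (origin e == u) && word_path (tau e) w v
  end.

Lemma word_path_cat u w1 w2 v :
  word_path u (w1 ++ w2) v <->
  exists2 x, word_path u w1 x & word_path x w2 v.
Proof.
elim: w1 u => [|[[x g]|e] w1 IH] u /=.
- by split=> [|[x /eqP <-]] //; exists u.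
- by case: eqP => _ /=; [exact: IH|split=> [|[]]].
- by case: eqP => _ /=; [exact: IH|split=> [|[]]].
Qed.

Lemma pi1_wordM (w1 w2 : seq (letter X)) :
  pi1_word T (w1 ++ w2) = pi1_word T w1 * pi1_word T w2.
Proof. by rewrite -pi1_opE. Qed.

Section Evaluation.
Variables (O : finType) (rho : forall v : vertex X, vgroup v -> {perm O}).
Variable s : edge X -> {perm O}.

Definition eval_letter (l : letter X) : {perm O} :=
  match l with inl u => rho (projT2 u) | inr e => s e end.

(** Permutations are composed from left to right, so that words act on points
    from the right and are read in their natural order. *)
Definition eval (w : seq (letter X)) := \prod_(l <- w) eval_letter l.

Lemma eval_cat w1 w2 : eval (w1 ++ w2) = eval w1 * eval w2.
Proof. exact: big_cat. Qed.

Lemma eval1 l : eval [:: l] = eval_letter l.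
Proof. exact: big_seq1. Qed.

Hypothesis rhoM : forall v, {morph @rho v : x y / x * y}.
Hypothesis s_bar : forall e, s (bar e) = (s e)^-1.
Hypothesis s_edge : forall e (g : egroup e.1),
  s e * rho (zeta e g) * s (bar e) = rho (zeta (bar e) g).

Lemma eval_pi1_eq : (forall e : edge X, e.1 \in T -> s e = 1) ->
  forall w1 w2, pi1_eq T w1 w2 -> eval w1 = eval w2.
Proof.
move=> sT w1 w2; elim=> // {w1 w2}.
- by move=> w1 w2 w3 _ -> _ ->.
- by move=> w1 w2 w3 w4 _ E _ E'; rewrite !eval_cat E E'.
- by move=> v; rewrite eval1 /= (morph_group1 (@rhoM v)) [RHS]big_nil.
- by move=> v g h; rewrite -[[:: _; _]]cat1s eval_cat !eval1 /= rhoM.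
- by move=> e; rewrite -[[:: _; _]]cat1s eval_cat !eval1 /= s_bar mulgV [RHS]big_nil.
- move=> e g; rewrite -[[:: _; _; _]]cat1s eval_cat -[[:: _; _]]cat1s.
  by rewrite eval_cat !eval1 /= mulgA s_edge.
- by move=> e Te; rewrite eval1 /= sT // [RHS]big_nil.
Qed.

Lemma pi1_representation : (forall e : edge X, e.1 \in T -> s e = 1) ->
  exists phi : pi1 T -> {perm O},
    {morph phi : x y / x * y} /\ forall w, phi (pi1_word T w) = eval w.
Proof.
move=> sT; exists (fun x => eval (pi1_repr x)).
have E w : eval (pi1_repr (pi1_word T w)) = eval w.
  by apply: eval_pi1_eq => //; apply/pi1_wordP; rewrite pi1_reprK.
split=> // x y; rewrite -[x]pi1_reprK -[y]pi1_reprK.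
by rewrite -pi1_wordM !E eval_cat.
Qed.
End Evaluation.

(** The permutations attached to the edges of the tree become trivial after
    conjugating the representations of the vertex groups by a potential of the
    tree. *)
Lemma twisted_representation (O : finType)
    (rho : forall v : vertex X, vgroup v -> {perm O}) (s : edge X -> {perm O}) :
  spanning_tree T ->
  (forall v, {morph @rho v : x y / x * y}) ->
  (forall e, s (bar e) = (s e)^-1) ->
  (forall e (g : egroup e.1),
    s e * rho _ (zeta e g) * s (bar e) = rho _ (zeta (bar e) g)) ->
  exists (phi : pi1 T -> {perm O}) (h : vertex X -> {perm O}),
    {morph phi : x y / x * y} /\
    forall u w v, word_path u w v ->
      phi (pi1_word T w) = (h u)^-1 * eval rho s w * h v.
Proof.
move=> [_ acycT] rhoM s_bar s_edge.
have [h hT] := forest_potential acycT s_bar.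
pose rho' v (g : vgroup v) := (h v)^-1 * rho v g * h v.
pose s' e := (h (origin e))^-1 * s e * h (tau e).
have [|||| phi [phiM phiE]] := @pi1_representation O rho' s'.
- by move=> v x y; rewrite /rho' rhoM !mulgA mulgK.
- move=> e; rewrite /s' origin_bar tau_bar s_bar !invgM invgK.
  by rewrite !mulgA.
- move=> e g; rewrite /rho' -s_edge /s' origin_bar !tau_bar.
  by rewrite !mulgA !mulgK.
- by move=> e Te; rewrite /s' hT // invgM -!mulgA mulKg mulVg.
exists phi, h; split=> // u w v; rewrite phiE.
elim: w u => [|[[x g]|e] w IH] u /=.
- by move=> /eqP <-; rewrite /eval !big_nil mulg1 mulVg.
- move=> /andP[/eqP <- /IH]; rewrite /eval !big_cons => ->.
  by rewrite /= /rho' !mulgA mulgK.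
- move=> /andP[/eqP <- /IH]; rewrite /eval !big_cons => ->.
  by rewrite /= /s' !mulgA mulgK.
Qed.

(** Freeness of the actions of the quotients by a compatible family makes the
    two actions of each edge group isomorphic, even with a partial isomorphism
    prescribed. *)
Lemma edge_permutations A N (O : finType)
    (rho : forall v : vertex X, vgroup v -> {perm O})
    (R : edge X -> O -> O -> Prop) :
  compatible A N ->
  (forall v, {morph @rho v : x y / x * y}) ->
  (forall v g o, rho v g o = o <-> A v g) ->
  (forall e (h : egroup e.1) x y,
    R e x y -> R e (rho _ (zeta (bar e) h) x) (rho _ (zeta e h) y)) ->
  (forall e x y, R e x y -> R (bar e) y x) ->
  (forall e x y y', R e x y -> R e x y' -> y = y') ->
  exists s : edge X -> {perm O},
    [/\ forall e, s (bar e) = (s e)^-1,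
        forall e (g : egroup e.1),
          s e * rho _ (zeta e g) * s (bar e) = rho _ (zeta (bar e) g) &
        forall e x y, R e x y -> s e x = y].
Proof.
move=> [_ AN] rhoM rhoA Rinv Rbar Rf.
have Hs (d : gedge X) : exists sd : {perm O},
    (forall (h : egroup d) x,
      sd (rho _ (zeta (d, false) h) x) = rho _ (zeta (d, true) h) (sd x)) /\
    forall x y, R (d, true) x y -> sd x = y.
  apply: (@extend_equivariant _ _ (fun h => rho _ (zeta (d, false) h))
    (fun h => rho _ (zeta (d, true) h)) (N d)).
  - by move=> x y; rewrite gmulfM rhoM.
  - by move=> x y; rewrite gmulfM rhoM.
  - by move=> h x; rewrite rhoA (AN (d, false)).
  - by move=> h x; rewrite rhoA (AN (d, true)).
  - by move=> h x y; apply: (Rinv (d, true)).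
  - exact: Rf.
  - by move=> x x' y /Rbar Rxy /Rbar; exact: Rf Rxy.
pose sd d := projT1 (cid (Hs d)).
have sdP d := projT2 (cid (Hs d)); rewrite -/sd in sdP.
exists (fun e => if e.2 then sd e.1 else (sd e.1)^-1); split.
- by case=> d [] /=; rewrite ?invgK.
- have sE d (g : egroup d) : sd d * rho _ (zeta (d, true) g) =
      rho _ (zeta (d, false) g) * sd d.
    by apply/permP => o; rewrite !permM (sdP d).1.
  case=> d [] g /=; first by rewrite sE mulgK.
  by rewrite -mulgA -sE mulKg.
- case=> d [] x y /= Rxy; first by apply: (sdP d).2.
  by rewrite -((sdP d).2 y x (Rbar _ _ _ Rxy)) permK.
Qed.

End Representation.

(** A set whose cardinal is a common multiple of the indices carries free actions of
    all the quotients. *)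
Lemma free_family (X : graph_of_groups) (A : forall v : vertex X, set (vgroup v)) :
  (forall v, finite_index_normal (A v)) ->
  exists (O : finType) (o : O) (rho : forall v : vertex X, vgroup v -> {perm O}),
    (forall v, {morph @rho v : x y / x * y}) /\
    forall v g x, rho v g x = x <-> A v g.
Proof.
move=> fA; pose n v := projT1 (cid (free_representation (fA v))).
have nP v := projT2 (cid (free_representation (fA v))); rewrite -/n in nP.
pose m := (\prod_v n v)%N.
have m_gt0 : (0 < m)%N by apply: prodn_gt0 => v; case: (nP v).
have Hr v : exists r : vgroup v -> {perm 'I_m},
    {morph r : x y / x * y} /\ forall g o, r g o = o <-> A v g.
  by apply: (nP v).2; rewrite card_ord /m (bigD1 v) //= dvdn_mulr.
exists 'I_m, (Ordinal m_gt0), (fun v => projT1 (cid (Hr v))).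
by split=> v; have [] := projT2 (cid (Hr v)).
Qed.

(** * Reduced words *)

Section ReducedWords.
Variables (X : graph_of_groups) (T : {set gedge X}).

Definition reduced (w : seq (letter X)) :=
  [/\ forall w1 w2 a b, w <> w1 ++ [:: inl a; inl b] ++ w2,
      forall w1 w2 e, w <> w1 ++ [:: eletter e; eletter (bar e)] ++ w2 &
      forall w1 w2 e (g : egroup e.1),
        w <> w1 ++ [:: eletter e; vletter (zeta e g); eletter (bar e)] ++ w2].

Lemma tree_word u v : connect (adjacent T) u v ->
  exists p : seq (letter X), word_path u p v /\ pi1_word T p = 1.
Proof.
move=> /connectP[p + ->]; elim: p u => [|x p IH] u /=.
  by exists [::]; rewrite /= eqxx.
case/andP=> /adjacentP[e [Te <- <-]] /IH[q [qp q1]].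
exists (eletter e :: q); rewrite /= eqxx qp; split=> //.
rewrite -cat1s pi1_wordM q1 mulg1; apply/pi1_wordP; exact: pi1_tree.
Qed.

(** Inserting paths in the tree between the letters turns any word into a closed
    path without changing the element it represents. *)
Lemma closed_word v (w : seq (letter X)) : connected T ->
  exists w', word_path v w' v /\ pi1_word T w' = pi1_word T w.
Proof.
move=> [_ cT]; elim: w => [|l w [w' [w'p Ew]]].
  by exists [::]; rewrite /= eqxx.
have [x [y lp]] : exists x y, word_path x [:: l] y.
  by case: l => [[x g]|e]; [exists x, x|exists (origin e), (tau e)]; rewrite /= !eqxx.
have [p [pp p1]] := tree_word (cT v x); have [q [qp q1]] := tree_word (cT y v).
exists (p ++ [:: l] ++ q ++ w'); rewrite -[l :: w]cat1s !pi1_wordM p1 q1 Ew !mul1g.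
split=> //; apply/word_path_cat; exists x => //.
by apply/word_path_cat; exists y => //; apply/word_path_cat; exists v.
Qed.

(** A shortest closed word representing [x] is reduced: each forbidden pattern can
    be replaced with a shorter word that joins the same vertices. *)
Lemma reduced_word v (x : pi1 T) : connected T ->
  exists w, [/\ word_path v w v, reduced w & pi1_word T w = x].
Proof.
move=> cT; pose P n := `[< exists w,
  [/\ size w = n, word_path v w v & pi1_word T w = x] >].
have exP : exists n, P n.
  have [w [wp wx]] := closed_word v (pi1_repr x) cT.
  by exists (size w); apply/asboolP; exists w; rewrite wx pi1_reprK.
case: (ex_minnP exP) => n /asboolP[w [wn wp wx]] minw.
have short w1 m w2 m' : w = w1 ++ m ++ w2 -> (size m' < size m)%N ->
    pi1_eq T m m' -> (forall a b, word_path a m b -> word_path a m' b) -> False.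
  move=> E m'm /pi1_wordP Em Hm; have : P (size (w1 ++ m' ++ w2)).
    apply/asboolP; exists (w1 ++ m' ++ w2); split=> //.
      move: wp; rewrite E => /word_path_cat[a w1p /word_path_cat[b mp w2p]].
      apply/word_path_cat; exists a => //.
      by apply/word_path_cat; exists b => //; exact: Hm.
    by rewrite -wx E !pi1_wordM Em.
  by move=> /minw; rewrite -wn E !size_cat leq_add2l leq_add2r leqNgt m'm.
exists w; split=> //; split.
- move=> w1 w2 [a g] [b h] E.
  have ab : a = b.
    move: wp; rewrite E => /word_path_cat[c _ /word_path_cat[d + _]] /=.
    by move=> /and3P[/eqP -> /eqP].
  subst b; apply: short E _ (pi1_mul T g h) _ => // c d.
  by move=> /= /and3P[-> _ ->].
- move=> w1 w2 e E; apply: short E _ (pi1_rev T e) _ => // c d.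
  by rewrite /= origin_bar tau_bar => /and3P[/eqP -> _ /eqP ->].
- move=> w1 w2 e g E; apply: short E _ (pi1_edge T g) _ => // c d /=.
  by rewrite !tau_bar => /and4P[/eqP <- _ _ /eqP <-]; rewrite !eqxx.
Qed.

Definition is_edge (l : letter X) := if l is inr _ then true else false.

Definition edge_count : seq (letter X) -> nat := count is_edge.

Lemma edge_count_cat w1 w2 :
  edge_count (w1 ++ w2) = (edge_count w1 + edge_count w2)%N.
Proof. exact: count_cat. Qed.

Lemma edge_count0_vertex v w : word_path v w v -> edge_count w = 0 ->
  exists g : vgroup v, pi1_word T w = pi1_vertex T g.
Proof.
elim: w => [|[[x g]|e] w IH] //=.
  by exists 1; apply/esym/pi1_wordP; exact: pi1_one.
move=> /andP[/eqP E wp]; subst x.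
rewrite /edge_count /= add0n => /(IH wp)[h Eh].
exists (g * h); rewrite -cat1s pi1_wordM Eh /pi1_vertex -pi1_wordM.
by apply/pi1_wordP; exact: pi1_mul.
Qed.

Lemma edge_position (w1 w2 w1' w2' : seq (letter X)) e e' :
  w1 ++ eletter e :: w2 = w1' ++ eletter e' :: w2' ->
  edge_count w1 = edge_count w1' -> w1 = w1' /\ e = e'.
Proof.
elim: w1 w1' => [|l w1 IH] [|l' w1'] //=.
- by case.
- by move=> [<- _].
- by move=> [-> _].
- by move=> [-> /IH E] /addnI /E[-> ->].
Qed.

Lemma edge_next_position (w1 w2 w1' w2' : seq (letter X)) e e' :
  w1 ++ eletter e :: w2 = w1' ++ eletter e' :: w2' ->
  edge_count w1 = (edge_count w1').+1 ->
  exists2 m, w1 = w1' ++ eletter e' :: m & edge_count m = 0.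
Proof.
elim: w1' w1 => [|l' w1' IH] [|l w1] //=.
  by move=> [-> _] [E]; exists w1.
move=> [-> /IH E]; rewrite /edge_count /= -addnS => /addnI /E[m -> m0].
by exists m.
Qed.

End ReducedWords.

(** * Separating a reduced word from a vertex group *)

Section Separation.
Variables (X : graph_of_groups) (O : finType) (o : O).
Variable rho : forall v : vertex X, vgroup v -> {perm O}.
Variable w : seq (letter X).
Hypothesis rhoM : forall v, {morph @rho v : x y / x * y}.

Let copies := (O * 'I_(size w).+1)%type.

Lemma copies_inj v (g : vgroup v) :
  injective (fun p : copies => (rho g p.1, p.2)).
Proof. by move=> [x i] [y j] [/perm_inj -> ->]. Qed.

Definition copies_rho v (g : vgroup v) : {perm copies} := perm (@copies_inj v g).

Lemma copies_rhoE v (g : vgroup v) x i : copies_rho g (x, i) = (rho g x, i).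
Proof. by rewrite permE. Qed.

Lemma copies_rhoM v : {morph @copies_rho v : x y / x * y}.
Proof.
by move=> g h; apply/permP => -[x i]; rewrite permM !copies_rhoE rhoM permM.
Qed.

Definition step (x : O) (l : letter X) : O :=
  if l is inl u then rho (projT2 u) x else o.

(** The trajectory that the word is meant to follow: a vertex letter moves the
    point inside its copy of [O], an edge letter sends it to the base point of the
    next copy. *)
Definition trajectory (w1 : seq (letter X)) : copies :=
  (foldl step o w1, inord (edge_count w1)).

Definition transition (e : edge X) (p q : copies) :=
  exists w1 w2, [/\ w = w1 ++ eletter e :: w2, p = trajectory w1 &
                    q = trajectory (w1 ++ [:: eletter e])].

Lemma edge_count_prefix w1 w2 : w = w1 ++ w2 -> (edge_count w1 < (size w).+1)%N.
Proof. by move=> ->; rewrite ltnS size_cat (leq_trans (count_size _ _)) ?leq_addr. Qed.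

Lemma trajectory_copy_inj w1 w2 w1' w2' :
  w = w1 ++ w2 -> w = w1' ++ w2' ->
  (trajectory w1).2 = (trajectory w1').2 -> edge_count w1 = edge_count w1'.
Proof.
move=> E E' /(congr1 (@nat_of_ord _)).
by rewrite !inordK ?(edge_count_prefix E) ?(edge_count_prefix E').
Qed.

Lemma transition_count e p q : transition e p q -> exists w1 w2,
  [/\ w = w1 ++ eletter e :: w2, p = trajectory w1,
      q = trajectory (w1 ++ [:: eletter e]) &
      w = (w1 ++ [:: eletter e]) ++ w2].
Proof. by move=> [w1 [w2 [E -> ->]]]; exists w1, w2; rewrite -catA. Qed.

(** A letter [bar e] of the word prescribes the inverse of the permutation attached
    to [e]. *)
Definition matching (e : edge X) (p q : copies) :=
  transition e p q \/ transition (bar e) q p.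

Definition orbit_matching (e : edge X) (p q : copies) :=
  exists (h : egroup e.1) p0 q0,
    [/\ matching e p0 q0, p = copies_rho (zeta (bar e) h) p0 &
        q = copies_rho (zeta e h) q0].

Variables (A : forall v : vertex X, set (vgroup v))
          (N : forall d : gedge X, set (egroup d)).
Hypothesis AN : compatible A N.
Hypothesis rhoA : forall v (g : vgroup v) x, rho g x = x <-> A g.
Variable v0 : vertex X.
Hypothesis w_path : word_path v0 w v0.
Hypothesis w_reduced : reduced w.
Hypothesis w_sep : forall (e : edge X) (g : vgroup (tau e)),
  vletter g \in w -> ~ range (zeta e) g -> forall k, ~ A (g * zeta e k).

Lemma copies_rhoA v (g : vgroup v) p : copies_rho g p = p <-> A g.
Proof.
by case: p => x i; rewrite copies_rhoE -(rhoA g x); split=> [[]|->].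
Qed.

(** A point from which the word leaves along [bar e] is never in the orbit, under
    the edge group, of a point that the word reaches along [e]: otherwise the
    letter between these two edges would lie in the image of the edge group
    modulo [A], although the word is reduced. *)
Lemma no_backtrack (e : edge X) p q p' q' (k : egroup e.1) :
  transition e q p -> transition (bar e) p' q' ->
  copies_rho (zeta e k) p' <> p.
Proof.
move=> /transition_count[w1 [w2 [E _ -> E1]]].
move=> /transition_count[w1' [w2' [E' -> _ _]]].
have [r1 r2 r3] := w_reduced.
rewrite /trajectory copies_rhoE => -[Ek /(trajectory_copy_inj E' E1)].
rewrite edge_count_cat /= addn1 => cnt.
have [m Em m0] := edge_next_position (etrans (esym E') E) cnt.
move: Ek; rewrite Em foldl_cat /= foldl_cat /=.
case: m m0 Em => [|[[x g]|//] [|[b|//] m]] //= _ Em Ek.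
- by apply: (r2 w1 w2' e); rewrite E' Em -catA.
- have xe : x = tau e.
    move: w_path; rewrite E' Em -catA => /word_path_cat[c _] /=.
    by move=> /and3P[_ /eqP ->].
  subst x; have gw : vletter g \in w.
    by rewrite E' Em !mem_cat inE inE eqxx !orbT.
  (* the letter between the two edges: in the edge group, the word would not be
     reduced; outside it, [w_sep] keeps it outside modulo [A] *)
  have [[h _ hg]|gN] := pselect (range (zeta e) g).
    by apply: (r3 w1 w2' e h); rewrite E' Em -catA hg.
  by apply: (w_sep gw gN (k := k)); rewrite -(rhoA _ o) rhoM permM.
- by apply: (r1 (w1 ++ [:: eletter e]) (m ++ eletter (bar e) :: w2')
               (existT _ x g) b); rewrite E' Em -!catA.
Qed.

(** The copy of a point determines the position in the word of the edge letter that
    leaves it, or of the edge letter that leads to it. Two prescriptions for one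
    orbit therefore agree unless one leaves a point reached by the other. *)
Lemma matching_functional (e : edge X) p q p' q' (k : egroup e.1) :
  matching e p q -> matching e p' q' -> copies_rho (zeta (bar e) k) p = p' ->
  p = p' /\ q = q'.
Proof.
have copyk (x : copies) : (copies_rho (zeta (bar e) k) x).2 = x.2.
  by case: x => x i; rewrite copies_rhoE.
move=> [epq|epq] [epq'|epq'] Ek.
- have [w1 [w2 [E Ep Eq E1]]] := transition_count epq.
  have [w1' [w2' [E' Ep' Eq' E1']]] := transition_count epq'.
  have cnt : edge_count w1 = edge_count w1'.
    by apply: trajectory_copy_inj E E' _; rewrite -Ep -Ep' -Ek copyk.
  have [Ew _] := edge_position (etrans (esym E) E') cnt.
  by rewrite Ep Eq Ep' Eq' Ew.
- exfalso; case: e k copyk epq epq' Ek => d b k _ epq epq'.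
  by case: b k epq epq' => k epq epq'; exact: no_backtrack epq' epq.
- exfalso; case: e k copyk epq epq' Ek => d b k _ epq epq' Ek.
  have {Ek} : copies_rho (zeta (bar (d, b)) k^-1) p' = p.
    by rewrite -Ek gmulfV (morph_groupV (@copies_rhoM _)) permK.
  by case: b k epq epq' => k epq epq'; exact: no_backtrack epq epq'.
- have [w1 [w2 [E Eq Ep E1]]] := transition_count epq.
  have [w1' [w2' [E' Eq' Ep' E1']]] := transition_count epq'.
  have : edge_count (w1 ++ [:: eletter (bar e)]) =
         edge_count (w1' ++ [:: eletter (bar e)]).
    by apply: trajectory_copy_inj E1 E1' _; rewrite -Ep -Ep' -Ek copyk.
  rewrite !edge_count_cat => /addIn cnt.
  have [Ew _] := edge_position (etrans (esym E) E') cnt.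
  by rewrite Ep Eq Ep' Eq' Ew.
Qed.

Lemma orbit_matching_functional (e : edge X) p q q' :
  orbit_matching e p q -> orbit_matching e p q' -> q = q'.
Proof.
move=> [h [p0 [q0 [m0 Ep ->]]]] [h' [p1 [q1 [m1 Ep' ->]]]].
have alM : {morph (fun k => copies_rho (zeta (bar e) k)) : x y / x * y}.
  by move=> x y; rewrite gmulfM copies_rhoM.
have beM : {morph (fun k => copies_rho (zeta e k)) : x y / x * y}.
  by move=> x y; rewrite gmulfM copies_rhoM.
have [E0 E1] : p0 = p1 /\ q0 = q1.
  apply: (matching_functional (k := h / h')) m0 m1 _.
  by rewrite alM permM -Ep Ep' (morph_groupV alM) permK.
have alN g x : copies_rho (zeta (bar e) g) x = x <-> N g.
  by rewrite copies_rhoA (AN.2 (bar e)).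
have beN g x : copies_rho (zeta e g) x = x <-> N g.
  by rewrite copies_rhoA (AN.2 e).
rewrite -E1; apply/(free_orbit_map beM beN)/(free_orbit_map alM alN h h' p0).1.
by rewrite -Ep Ep' E0.
Qed.

Lemma separating_representation (T : {set gedge X}) :
  spanning_tree T -> (0 < edge_count w)%N ->
  exists phi : pi1 T -> {perm copies},
    {morph phi : x y / x * y} /\
    forall g : vgroup v0, phi (pi1_word T w) <> phi (pi1_vertex T g).
Proof.
move=> sT w_gt0.
have [|||||s [s_bar s_edge sR]] := @edge_permutations X A N copies
  copies_rho orbit_matching AN.
- exact: copies_rhoM.
- exact: copies_rhoA.
- move=> e h x y [k [p0 [q0 [m0 -> ->]]]]; exists (k * h), p0, q0.
  by rewrite !gmulfM !copies_rhoM !permM.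
- case=> d b x y [k [p0 [q0 [m0 -> ->]]]]; exists k, q0, p0.
  by case: b k m0 => k [m0|m0]; split=> //; [right|left|right|left].
- exact: orbit_matching_functional.
have [phi [h [phiM phiE]]] :=
  twisted_representation sT (@copies_rhoM) s_bar s_edge.
exists phi; split=> // g; rewrite (phiE _ _ _ w_path) (phiE v0 _ v0) /= ?eqxx //.
move=> /mulIg /mulgI E.
(* prefixes move the base point of the first copy along the trajectory *)
have follow w1 w2 : w = w1 ++ w2 -> eval copies_rho s w1 (o, ord0) = trajectory w1.
  elim/last_ind: w1 w2 => [|w1 l IH] w2.
    have -> : ord0 = inord 0 :> 'I_(size w).+1 by apply: val_inj; rewrite /= inordK.
    by rewrite /eval big_nil perm1.
  rewrite cat_rcons => Ew; rewrite -cats1 eval_cat permM (IH _ Ew) eval1.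
  case: l Ew => [[x a]|e] Ew /=.
    by rewrite /trajectory copies_rhoE edge_count_cat addn0 foldl_cat.
  apply: sR; exists 1, (trajectory w1), (trajectory (w1 ++ [:: eletter e])).
  rewrite !gmulf1 !(morph_group1 (@copies_rhoM _)) !perm1; split=> //.
  by left; exists w1, w2.
have /esym := follow w [::] (esym (cats0 w)).
rewrite E eval1 copies_rhoE => -[_ /(congr1 (@nat_of_ord _))].
rewrite inordK ?(edge_count_prefix (esym (cats0 w))) // => w0.
by rewrite w0 in w_gt0.
Qed.

End Separation.

(** * The profinite topology *)

Lemma profinite_openP (G : groupType) (U : set G) :
  profinite_open U <->
  forall x, U x -> exists H, finite_index setT H /\ left_coset x H `<=` U.
Proof.
split=> [[D DB <-] x [C DC Cx]|HU].
  have [y [H [fH E]]] := DB _ DC; exists H; split=> //.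
  have [gH _ _] := fH; rewrite /id E in Cx.
  rewrite (left_coset_eq gH Cx) => z Hz; exists C => //.
  by rewrite /id E.
exists [set C | finite_index_coset C /\ C `<=` U]; first by move=> C [].
apply/seteqP; split=> [x [C [_ CU] /CU]//|x Ux].
have [H [fH HU']] := HU _ Ux; have [gH _ _] := fH.
exists (left_coset x H); last exact: left_coset_refl.
by split=> //; exists x, H.
Qed.

Lemma separableP (G : groupType) (A : set G) :
  separable A <->
  forall x, ~ A x ->
    exists H, finite_index setT H /\ forall y, A y -> ~ H (x^-1 * y).
Proof.
have -> : separable A <-> profinite_open (~` A).
  split; first exact: closed_openC.
  by move=> /open_closedC; rewrite setCK.
rewrite profinite_openP; split=> HA x /HA [H [fH HH]]; exists H; split=> //.
  by move=> y Ay Hxy; apply: (HH y) => //; rewrite left_cosetE.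
by move=> y; rewrite left_cosetE => Hxy Ay; exact: HH Hxy.
Qed.

Lemma induced_openP (H G : groupType) (f : H -> G) (U : set H) :
  induced_open f U <-> exists2 V, profinite_open V & f @^-1` V = U.
Proof. by []. Qed.

(** * Vertex groups in a fundamental group *)

Lemma common_refinement (X : graph_of_groups) (I : eqType) (r : seq I)
    (P : I -> (forall v : vertex X, set (vgroup v)) -> Prop) :
  (forall i K K', (forall v, K' v `<=` K v) -> P i K -> P i K') ->
  (forall i, exists K, (forall v, finite_index_normal (K v)) /\ P i K) ->
  exists K, (forall v, finite_index_normal (K v)) /\ forall i, i \in r -> P i K.
Proof.
move=> Pmono Pex; elim: r => [|i r [K [fK KP]]].
  by exists (fun v => setT); split=> // v; exact: finite_index_normalT.
have [K' [fK' K'P]] := Pex i; exists (fun v => K v `&` K' v); split=> [v|j].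
  exact: finite_index_normalI.
rewrite inE => /orP[/eqP ->|/KP].
  by apply: Pmono K'P => v; exact: subIsetr.
by apply: Pmono => v; exact: subIsetl.
Qed.

Lemma update_family (X : graph_of_groups) v (K : set (vgroup v)) :
  finite_index setT K -> exists K' : forall v : vertex X, set (vgroup v),
    (forall u, finite_index_normal (K' u)) /\ K' v = normal_core K.
Proof.
move=> fK; exists (dfwith (fun u : vertex X => [set: vgroup u]) v (normal_core K)).
split=> [u|]; last exact: dfwithin.
case: dfwithP => [|j _]; first exact: normal_core_finite_index.
exact: finite_index_normalT.
Qed.

(** Only finitely many pairs of a letter of [w] and an edge are involved, and each
    requirement persists in smaller subgroups. *)
Lemma separating_family (X : graph_of_groups) (w : seq (letter X)) :
  (forall e : edge X, separable (range (zeta e))) ->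
  exists K : forall v : vertex X, set (vgroup v),
    (forall v, finite_index_normal (K v)) /\
    forall (e : edge X) (g : vgroup (tau e)),
      vletter g \in w -> ~ range (zeta e) g -> forall k, ~ K (tau e) (g * zeta e k).
Proof.
move=> sep.
pose P (le : letter X * edge X) (K : forall v : vertex X, set (vgroup v)) :=
  forall g : vgroup (tau le.2), le.1 = vletter g ->
    ~ range (zeta le.2) g -> forall k, ~ K (tau le.2) (g * zeta le.2 k).
have [||K [fK KP]] := @common_refinement X _ [seq (l, e) | l <- w, e <- enum (edge X)] P.
- by move=> i K K' KK' HP g Eg gN k /KK'; exact: HP.
- case=> l e; have [[g [Eg gN]]|no] :=
      pselect (exists g : vgroup (tau e), l = vletter g /\ ~ range (zeta e) g).
    have [H [fH HH]] := (separableP _).1 (sep e) g gN.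
    have [K [fK KE]] := update_family fH; exists K; split=> // g' /=.
    rewrite Eg => gg'; have {gg'} <- : g = g'.
      apply: (@eq_from_Tagged _ (fun v : vertex X => vgroup v)).
      by move: gg'; rewrite /vletter => -[].
    move=> _ k; rewrite KE => Kgk.
    apply: (HH (zeta e k^-1)); first by exists k^-1.
    have [[gK _ _] nK] := fK (tau e); rewrite KE in gK nK.
    (* conjugating the inverse of [g * zeta e k] yields [g^-1 * zeta e k^-1] *)
    have := nK (zeta e k)^-1 _ Logic.I (subgroupV gK Kgk).
    rewrite conjgE invgK invgM -mulgA mulVKg gmulfV; exact: normal_core_sub.
  exists (fun v => setT); split=> [v|g Eg gN]; first exact: finite_index_normalT.
  by exfalso; apply: no; exists g.
exists K; split=> // e g gw; apply: (KP (vletter g, e)) => //.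
by apply: allpairs_f; rewrite ?mem_enum.
Qed.

Section Splitting.
Variables (G : groupType) (X : graph_of_groups) (S : splitting G X).

Lemma vertex_inclM v : {morph @vertex_incl G X S v : g h / g * h}.
Proof.
move=> g h; rewrite /vertex_incl -gmulfM; congr (iso S _).
by rewrite /pi1_vertex -pi1_wordM; apply/pi1_wordP/pi1_sym/pi1_mul.
Qed.

Lemma representation_kernel (O : finType) (phi : pi1 (tree S) -> {perm O}) :
  {morph phi : x y / x * y} ->
  exists H, finite_index setT H /\ forall x, H (iso S x) <-> phi x = 1.
Proof.
move=> phiM; have [g gK Kg] := iso_bij S.
have gM : {morph g : x y / x * y}.
  by move=> x y; apply: (can_inj gK); rewrite gmulfM !Kg.
have fM : {morph phi \o g : x y / x * y} by move=> x y; rewrite /= gM phiM.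
exists [set x | phi (g x) = 1]; split=> [|x]; last by rewrite /= gK.
apply: (@finite_index_of_coloring _ _ {perm O} (phi \o g)).
  split=> [|x y /= x1 y1]; first exact: (morph_group1 fM).
  rewrite -[LHS]/((phi \o g) (x / y)) fM (morph_groupV fM) /= x1 y1.
  by rewrite mul1g invg1.
move=> x y xy; rewrite -[_ _]/((phi \o g) (x^-1 * y) = 1).
by rewrite fM (morph_groupV fM) xy mulVg.
Qed.

Hypothesis cmd : forall v : vertex X, commands (@incident X v).

(** The kernel of a representation built from a compatible family meets [G_v]
    exactly in the prescribed subgroup. *)
Lemma vertex_finite_index v (K : set (vgroup v)) : finite_index setT K ->
  exists H, finite_index setT H /\ vertex_incl S (v := v) @^-1` H `<=` K.
Proof.
move=> fK; have [K' [fK' K'E]] := update_family fK.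
have [A [N [AN AK']]] := compatible_refinement cmd fK'.
have [O [o [rho [rhoM rhoA]]]] := free_family AN.1.
have [//|//|//|s [s_bar s_edge _]] :=
  edge_permutations (R := fun _ _ _ => False) AN rhoM rhoA.
have [phi [h [phiM phiE]]] :=
  twisted_representation (tree_spanning S) rhoM s_bar s_edge.
have [H [fH HE]] := representation_kernel phiM.
exists H; split=> // g /HE.
rewrite (phiE v _ v) /= ?eqxx // eval1 /= => E.
apply: normal_core_sub; rewrite -K'E; apply/AK'/(rhoA _ _ o).
have -> : rho v g = h v * ((h v)^-1 * rho v g * h v) * (h v)^-1.
  by rewrite !mulgA mulgK mulgV mul1g.
by rewrite E mulg1 mulgV perm1.
Qed.

Lemma vertex_topology v (U : set (vgroup v)) :
  profinite_open U <-> induced_open (@vertex_incl G X S v) U.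
Proof.
set f := @vertex_incl G X S v.
have fM : {morph f : g h / g * h} := @vertex_inclM v.
rewrite induced_openP; split=> [/profinite_openP Uo|[V /profinite_openP Vo <-]].
  exists [set y | exists H, finite_index setT H /\
                    forall g, H (y^-1 * f g) -> U g].
    apply/profinite_openP => y [H [fH HU]]; exists H; split=> // z.
    rewrite left_cosetE => Hyz; exists H; split=> // g Hzg; apply: HU.
    have [gH _ _] := fH.
    have -> : y^-1 * f g = (y^-1 * z) * (z^-1 * f g) by rewrite mulgA mulgK.
    exact: subgroupM.
  apply/seteqP; split=> [g [H [[[H1 _] _ _] HU]]|g /Uo[K [fK KU]]].
    by apply: HU; rewrite mulVg.
  have [H [fH HK]] := vertex_finite_index fK; exists H; split=> // g' Hg.
  apply: KU; rewrite left_cosetE; apply: HK.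
  by rewrite /preimage /= -/f fM (morph_groupV fM).
apply/profinite_openP => g /Vo[H [fH HV]].
exists (f @^-1` H); split; first exact: finite_index_preimage.
move=> g'; rewrite left_cosetE /preimage /= fM (morph_groupV fM) => Hg.
by apply: HV; rewrite left_cosetE.
Qed.

(** An element outside [G_v] is represented by a reduced closed word with at
    least one edge. *)
Lemma vertex_separable v : (forall e : edge X, separable (range (zeta e))) ->
  separable (range (@vertex_incl G X S v)).
Proof.
move=> sep; apply/separableP => x xN.
have [g gK Kg] := iso_bij S.
have [w [w_path w_red Ew]] := reduced_word v (g x) (tree_spanning S).1.
have w_gt0 : (0 < edge_count w)%N.
  rewrite lt0n; apply/eqP => /(edge_count0_vertex (tree S) w_path)[a Ea].
  by apply: xN; exists a => //; rewrite /vertex_incl -Ea Ew Kg.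
have [K [fK KP]] := separating_family w sep.
have [A [N [AN AK]]] := compatible_refinement cmd fK.
have [O [o [rho [rhoM rhoA]]]] := free_family AN.1.
have [phi [phiM phiN]] : exists phi : pi1 (tree S) -> {perm O * 'I_(size w).+1},
    {morph phi : x y / x * y} /\
    forall a : vgroup v, phi (pi1_word _ w) <> phi (pi1_vertex _ a).
  apply: (separating_representation o rhoM AN rhoA w_path w_red) => //.
    by move=> e a aw aN k /AK; exact: KP.
  exact: tree_spanning.
have [H [fH HE]] := representation_kernel phiM.
exists H; split=> // _ [a _ <-].
rewrite -[x]Kg -gmulfV -gmulfM => /HE.
rewrite phiM (morph_groupV phiM) -Ew => E.
by apply: (phiN a); apply: (mulgI (phi (pi1_word _ w))^-1); rewrite E mulVg.
Qed.

(** The trivial subgroup is closed in a closed subgroup whose induced topology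
    is its own profinite topology. *)
Lemma splitting_residually_finite (v : vertex X) :
  residually_finite (vgroup v) ->
  (forall e : edge X, separable (range (zeta e))) -> residually_finite G.
Proof.
move=> rf sep; have fM := @vertex_inclM v; have f1 := morph_group1 fM.
apply/separableP => x x1.
have [[g _ gx]|xN] := pselect (range (@vertex_incl G X S v) x); last first.
  have [H [fH HN]] := (separableP _).1 (vertex_separable (v := v) sep) x xN.
  by exists H; split=> // _ ->; apply: HN; exists 1.
have g1 : g <> 1 by move=> g1; apply: x1; rewrite -gx g1 f1.
have [K [fK KN]] := (separableP _).1 rf g g1.
have [H [fH HK]] := vertex_finite_index fK.
exists H; split=> // _ ->; rewrite mulg1 -gx -(morph_groupV fM) => Hg.
by apply: (KN 1) => //; rewrite mulg1; exact: HK.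
Qed.

End Splitting.

Theorem proposition6p11 (G : groupType) (X : graph_of_groups)
    (connX : connected [set: gedge X]%SET) (s : splitting G X)
    (cmd : forall v : vertex X, commands (@incident X v)) :
  [/\ forall (v : vertex X) (U : set (vgroup v)),
        profinite_open U <-> induced_open (@vertex_incl G X s v) U,
      (forall e : edge X, separable (range (zeta e))) ->
        forall v : vertex X, separable (range (@vertex_incl G X s v)) &
      (forall v : vertex X, residually_finite (vgroup v)) ->
        (forall e : edge X, separable (range (zeta e))) ->
        residually_finite G].
Proof.
split=> [v U|sep v|rf sep].
- exact: vertex_topology.
- exact: vertex_separable.
- have /card_gt0P[v _] := connX.1.
  exact: splitting_residually_finite (rf v) sep.
Qed.
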